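(* Let $\varphi=\varphi(r,k)$ be a function with the following property: for all integers $k\geq 2$, $r\geq 1$ and every real $\alpha^*>0$ there exist $\epsilon^*>0$ and $t_0>0$ such that every $k$-uniform hypergraph $G$ on $t\geq t_0$ vertices with $e(G)\geq (1-\epsilon^* )\binom{t}{k}$ satisfies $\mathrm{mc}_r(G)\geq (\varphi-\alpha^* )t$. Then for any integers $k\geq 2$, $r\geq 1$, any real $\alpha>0$, and any $p=p(n)\in(0,1]$ such that $pn^{k-1}\to\infty$, asymptotically almost surely $\mathrm{mc}_r\left(\mathcal{H}^{(k)}(n,p)\right)\geq (\varphi-\alpha)n$.
   Context: A hypergraph $H=(V,E)$ is connected if its shadow graph (vertex set $V$, with $\{x,y\}$ an edge whenever $\{x,y\}\subseteq e$ for some $e\in E$) is connected; a component is a maximal connected subhypergraph, and its order is its number of vertices. For an $r$-coloring $\chi:E(H)\to[r]$ of the edges, a monochromatic component is a component of the subhypergraph formed by the edges of one color; $\mathrm{mc}(H,\chi)$ is the largest order of a monochromatic component, and $\mathrm{mc}_r(H)=\min_{\chi}\mathrm{mc}(H,\chi)$ over all $r$-colorings $\chi$. The random hypergraph $\mathcal{H}^{(k)}(n,p)$ is the $k$-uniform hypergraph on vertex set $[n]$ in which each $k$-subset of $[n]$ is an edge independently with probability $p$. An event holds asymptotically almost surely (a.a.s.) if its probability tends to $1$ as $n\to\infty$. $e(G)$ denotes the number of edges of $G$. *)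

(* Defs.v *)
From HB Require Import structures.
From mathcomp Require Import all_boot all_order all_algebra.
From mathcomp Require Import reals.
Set Implicit Arguments.
Unset Strict Implicit.
Unset Printing Implicit Defensive.
Import Order.TTheory GRing.Theory Num.Theory.
Local Open Scope ring_scope.

(* The vertex set is a subset of the ambient type [T], so that a hypergraph   *)
(* and its subhypergraphs inhabit the same (finite) type.                     *)
Record hypergraph (T : finType) := Hypergraph {
  hg_pair : {set T} * {set {set T}};
  _ : hg_pair.2 \subset powerset hg_pair.1 }.

HB.instance Definition _ (T : finType) := [isSub for @hg_pair T].
HB.instance Definition _ (T : finType) := [Finite of hypergraph T by <:].

Section Hypergraphs.
Variable T : finType.
Implicit Types (H C : hypergraph T) (E : {set {set T}}).

Definition vertices H : {set T} := (hg_pair H).1.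
Definition edges H : {set {set T}} := (hg_pair H).2.

Definition uniform (k : nat) H : bool := [forall e in edges H, #|e| == k].

Definition subhypergraph C H : bool :=
  (vertices C \subset vertices H) && (edges C \subset edges H).

Definition shadow H : rel T :=
  fun x y => (x != y) && [exists e in edges H, [set x; y] \subset e].

(* Since edges lie inside [vertices H], a shadow path between two vertices of *)
(* [H] never leaves [vertices H].                                             *)
Definition connected H : bool :=
  [forall x in vertices H, forall y in vertices H, connect (shadow H) x y].

Definition component C H : bool :=
  [&& subhypergraph C H, connected C &
      [forall D : hypergraph T,
         [&& subhypergraph D H, connected D & subhypergraph C D] ==> (D == C)]].

Lemma edges_sub_cover E : E \subset powerset (cover E).
Proof. by apply/subsetP => e eE; rewrite powersetE; exact: bigcup_sup. Qed.

Definition formed_by E : hypergraph T :=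
  @Hypergraph T (cover E, E) (edges_sub_cover E).

(* A coloring is given on all sets of vertices; only its values on the edges  *)
(* of the hypergraph at hand are ever used.                                   *)
Definition color_class (r : nat) H (chi : {ffun {set T} -> 'I_r}) (c : 'I_r) :
    hypergraph T :=
  formed_by [set e in edges H | chi e == c].

Definition mc (r : nat) H (chi : {ffun {set T} -> 'I_r}) : nat :=
  \max_(c < r) \max_(C : hypergraph T | component C (color_class H chi c))
    #|vertices C|.

(* [mc H chi] never exceeds [#|vertices H|], so for [0 < r] the default value *)
(* does not affect the minimum.                                               *)
Definition mc_min (r : nat) H : nat :=
  \big[minn/#|vertices H|]_(chi : {ffun {set T} -> 'I_r}) mc H chi.

End Hypergraphs.

(* The probability of the event [A] for the random hypergraph on ['I_n] in    *)
(* which each [k]-subset is an edge independently with probability [p].       *)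
Definition random_hypergraph_prob (R : realType) (k n : nat) (p : R)
    (A : pred (hypergraph 'I_n)) : R :=
  \sum_(H : hypergraph 'I_n | [&& vertices H == [set: 'I_n], uniform k H & A H])
    \prod_(e : {set 'I_n} | #|e| == k) (if e \in edges H then p else 1 - p).

(* Main.v *)
(* Fix a colouring all of whose monochromatic components have order less than *)
(* a n, where a = phi - alpha > 0. For each colour the components partition   *)
(* the vertices; greedily merging parts of size at most a n / 2 leaves a      *)
(* partition into boundedly many parts, M say, still of size at most a n, and *)
(* every edge lies inside one part of one of the r partitions. The k-graph of *)
(* all k-sets with this property has monochromatic components of order at     *)
(* most a n, so by hypothesis it misses a positive fraction of all k-sets,    *)
(* and the random hypergraph avoids the missed sets with probability          *)
(* exp(- Omega(p n^k)). Since n = o(p n^k), this beats the union bound over   *)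
(* only M^(r n) families of partitions.                                       *)

(* The union bound runs over families of [r] partitions instead of colourings: [M] depends on a
   alone, so their number [(M ^ n) ^ r] is exponential in n only. [edges_sub_coarsened] passes from
   a colouring to such a family, [mc_min_coarsened] makes the density hypothesis fail for the
   k-graph of that family, and [prob_sub_edges] gives the probability of lying inside a fixed
   k-graph. [prob_mc_min_le] combines the three. *)
Require Import Defs.
From HB Require Import structures.
From mathcomp Require Import all_boot all_order all_algebra.
From mathcomp Require Import all_classical all_reals all_analysis.
From mathcomp Require Import zify ring lra.
Set Implicit Arguments.
Unset Strict Implicit.
Unset Printing Implicit Defensive.
Import Order.TTheory GRing.Theory Num.Theory.
Import numFieldNormedType.Exports.
Local Open Scope nat_scope.

(* [f c] sends each vertex to its part in the partition for colour [c]. *)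
Definition coarsened_edges (T : finType) (r M k : nat)
    (f : {ffun 'I_r -> {ffun T -> 'I_M}}) : {set {set T}} :=
  [set e : {set T} | (#|e| == k) &&
     [exists c, forall x in e, forall y in e, f c x == f c y]].

(** * Merging small parts of a partition *)

(* Two fibres of size at most [d] can be merged within the bound [B]; if there *)
(* are no two such fibres, [m] of them have more than [d] elements.            *)
Lemma merge_fibres (T : finType) (m d B : nat) (f : T -> 'I_m.+1) :
  (0 < m)%N -> (#|T| < m * d.+1)%N -> (d.*2 <= B)%N ->
  (forall i, #|[set x | f x == i]| <= B)%N ->
  exists g : T -> 'I_m,
    (forall x y, f x = f y -> g x = g y) /\
    (forall i, #|[set x | g x == i]| <= B)%N.
Proof.
move=> m0 Tm dB fB.
have [/existsP[i /existsP[j /and3P[ij fi fj]]]|nex] :=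
    boolP [exists i, exists j, [&& i != j, #|[set x | f x == i]| <= d
                                  & #|[set x | f x == j]| <= d]%N].
(* Label [i] is deleted and its fibre joins that of [j], which is renamed [j']. *)
- have [j' jE _] := unlift_some ij.
  exists (fun x => odflt j' (unlift i (f x))); split=> [x y ->//|v].
  have [->|vj] := eqVneq v j'.
    apply: leq_trans dB; rewrite -addnn.
    apply: leq_trans (leq_add fi fj).
    apply: leq_trans (leq_card_setU _ _).1.
    apply/subset_leq_card/fintype.subsetP => x; rewrite !inE.
    by case: unliftP => [u ->|->] /=; rewrite ?eqxx// jE => /eqP ->; rewrite eqxx orbT.
  apply: leq_trans (fB (lift i v)).
  apply/subset_leq_card/fintype.subsetP => x; rewrite !inE.
  case: unliftP => [u ->|_] /=; first by move=> /eqP ->.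
  by rewrite eq_sym (negbTE vj).
- exfalso.
  have [i0 hi0] : exists i0, forall i, i != i0 -> (d < #|[set x | f x == i]|)%N.
    have [/existsP[i0 h0]|no] := boolP [exists i, #|[set x | f x == i]| <= d]%N.
      exists i0 => i ii0; rewrite ltnNge; apply/negP => hi.
      move/negP: nex; apply; apply/existsP; exists i; apply/existsP; exists i0.
      by rewrite ii0 hi h0.
    exists ord0 => i _; rewrite ltnNge; apply/negP => hi.
    by move/negP: no; apply; apply/existsP; exists i.
  have : (#|T| >= m * d.+1)%N; last by rewrite leqNgt Tm.
  have -> : #|T| = (\sum_(i : 'I_m.+1) #|[set x | f x == i]|)%N.
    rewrite -sum1_card (partition_big f xpredT)//=.
    by apply: eq_bigr => i _; rewrite sum1dep_card.
  rewrite (bigD1 i0)//=.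
  apply: (@leq_trans (\sum_(i < m.+1 | i != i0) d.+1)%N); last first.
    by apply: leq_trans (leq_addl _ _); apply: leq_sum => i /hi0.
  by rewrite sum_nat_const cardC1 card_ord.
Qed.

(** As long as more than [M] labels remain, [merge_fibres] removes one, because [#|T| < M * d.+1]
    only weakens as [M] grows. *)
Lemma merge_fibres_into (T : finType) (M d B : nat) (g : T -> T) :
  (0 < M)%N -> (#|T| < M * d.+1)%N -> (d.*2 <= B)%N ->
  (forall z, #|[set x | g x == z]| <= B)%N ->
  exists f : {ffun T -> 'I_M},
    (forall x y, g x = g y -> f x = f y) /\
    (forall i, #|[set x | f x == i]| <= B)%N.
Proof.
move=> M0 TM dB gB.
suff H : exists f : T -> 'I_M,
    (forall x y, g x = g y -> f x = f y) /\
    (forall i, #|[set x | f x == i]| <= B)%N.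
  have [f [f1 f2]] := H; exists (finfun f); split=> [x y xy|i].
    by rewrite !ffunE; exact: f1.
  by under eq_finset do rewrite ffunE.
have H m : (M <= m)%N -> (exists f : T -> 'I_m,
    (forall x y, g x = g y -> f x = f y) /\
    (forall i, #|[set x | f x == i]| <= B)%N) -> exists f : T -> 'I_M,
    (forall x y, g x = g y -> f x = f y) /\
    (forall i, #|[set x | f x == i]| <= B)%N.
  elim: m => [|m IH]; first by rewrite leqNgt M0.
  rewrite leq_eqVlt ltnS => /predU1P[->//|Mm] [f [f1 f2]].
  apply: IH => //.
  have m0 : (0 < m)%N by apply: leq_trans M0 _.
  have Tm : (#|T| < m * d.+1)%N by apply: leq_trans TM _; rewrite leq_mul2r Mm orbT.
  have [h [h1 h2]] := merge_fibres m0 Tm dB f2.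
  by exists h; split=> // x y /f1 /h1.
(* [M] empty labels are added so that the descent starts at or above [M]. *)
apply: (H (M + #|T|)%N); first exact: leq_addr.
exists (fun x => rshift M (enum_rank (g x))); split=> [x y -> //|i].
case: (splitP i) => j ij.
  rewrite (_ : [set x | _] = finset.set0) ?cards0//.
  apply/setP => x; rewrite !inE; apply/negbTE/eqP => /(congr1 val) /= h.
  by move: (ltn_ord j); rewrite -ij -h ltnNge leq_addr.
apply: leq_trans (gB (enum_val j)).
apply/subset_leq_card/fintype.subsetP => x; rewrite !inE => /eqP/(congr1 val) /=.
by rewrite ij => /addnI/val_inj <-; rewrite enum_rankK.
Qed.

(** * Components and the minimum over colourings *)

Lemma shadow_sym (T : finType) (H : hypergraph T) : symmetric (shadow H).
Proof. by move=> x y; rewrite /shadow eq_sym finset.setUC. Qed.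

Lemma edge_sub_vertices (T : finType) (H : hypergraph T) (e : {set T}) :
  e \in edges H -> e \subset vertices H.
Proof.
by case: H => [[V E] VE] /= eE; rewrite -powersetE; exact: (fintype.subsetP VE).
Qed.

Lemma connect_edge (T : finType) (H : hypergraph T) (e : {set T}) (x y : T) :
  e \in edges H -> x \in e -> y \in e -> connect (shadow H) x y.
Proof.
move=> eH xe ye; have [->//|xy] := eqVneq x y.
apply: connect1; rewrite /shadow xy; apply/existsP; exists e.
by rewrite eH finset.subUset !finset.sub1set xe ye.
Qed.

Lemma sub_connect_shadow (T : finType) (C H : hypergraph T) :
  edges C \subset edges H -> subrel (connect (shadow C)) (connect (shadow H)).
Proof.
move=> CH; apply: connect_sub => x y /andP[xy /existsP[e /andP[eC xye]]].
apply: connect1; rewrite /shadow xy; apply/existsP; exists e.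
by rewrite (fintype.subsetP CH).
Qed.

Lemma vertices_connect (T : finType) (H : hypergraph T) (x y : T) :
  x \in vertices H -> connect (shadow H) x y -> y \in vertices H.
Proof.
move=> xH xy; rewrite -(@closed_connect _ (shadow H) (vertices H) _ x y)// => u v.
move=> /andP[_ /existsP[e /andP[/edge_sub_vertices eH]]].
rewrite finset.subUset !finset.sub1set => /andP[ue ve].
by rewrite !(fintype.subsetP eH).
Qed.

Lemma connect_class_component (T : finType) (H : hypergraph T) (x : T) :
  x \in vertices H ->
  exists2 C, component C H & vertices C = [set y | connect (shadow H) x y].
Proof.
move=> xH; pose X := [set y | connect (shadow H) x y].
have EX : [set e in edges H | e \subset X] \subset powerset X.
  by apply/fintype.subsetP => e; rewrite inE powersetE => /andP[].
pose C := @Hypergraph T (X, [set e in edges H | e \subset X]) EX.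
have CH : edges C \subset edges H.
  by apply/fintype.subsetP => e; rewrite inE => /andP[].
(* An edge used by a shadow path from [x] consists of vertices reachable from [x], so it is an edge
   of [C]. *)
have cC u : u \in X -> connect (shadow C) x u.
  rewrite inE => /connectP[q + ->].
  elim/last_ind: q => [//|q v IH]; rewrite rcons_path last_rcons => /andP[qp qv].
  apply: (connect_trans (IH qp)); apply: connect1.
  move: qv => /andP[qv /existsP[e /andP[eH qve]]].
  rewrite /shadow qv; apply/existsP; exists e; rewrite qve andbT inE eH/=.
  apply/fintype.subsetP => w we; rewrite inE.
  apply: (@connect_trans _ _ (last x q)); first by apply/connectP; exists q.
  by apply: (connect_edge eH) => //; apply: (fintype.subsetP qve); rewrite !inE eqxx.
exists C => //; apply/and3P; split.
- rewrite /subhypergraph CH andbT; apply/fintype.subsetP => y; rewrite inE.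
  exact: vertices_connect.
- apply/forall_inP => u uX; apply/forall_inP => v vX.
  apply: connect_trans (cC v vX).
  by rewrite (sym_connect_sym (@shadow_sym _ C)) cC.
- apply/forallP => D; apply/implyP => /and3P[/andP[_ DH] cD /andP[VCD ECD]].
  have VD : vertices D = X.
    apply/eqP; rewrite finset.eqEsubset VCD andbT; apply/fintype.subsetP => y yD.
    rewrite inE; apply: (sub_connect_shadow DH).
    have xD : x \in vertices D by apply: (fintype.subsetP VCD); rewrite inE.
    by move/forall_inP: cD => /(_ _ xD)/forall_inP/(_ _ yD).
  have ED : edges D = edges C.
    apply/eqP; rewrite finset.eqEsubset ECD andbT; apply/fintype.subsetP => e eD.
    by rewrite inE (fintype.subsetP DH) //= -VD edge_sub_vertices.
  apply/eqP/val_inj => /=; move: VD ED; rewrite /vertices /edges /=.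
  by case: (hg_pair D) => /= ? ? -> ->.
Qed.

Lemma component_le_mc (T : finType) (r : nat) (H : hypergraph T)
    (chi : {ffun {set T} -> 'I_r}) (c : 'I_r) (C : hypergraph T) :
  component C (color_class H chi c) -> #|vertices C| <= mc H chi.
Proof.
move=> HC; apply: leq_trans (leq_bigmax c).
exact: (@leq_bigmax_cond _ (fun C => component C _) (fun C => #|vertices C|)).
Qed.

(* A vertex lying on no edge of the colour belongs to no component, hence the *)
(* [maxn 1].                                                                   *)
Lemma connect_class_le_mc (T : finType) (r : nat) (H : hypergraph T)
    (chi : {ffun {set T} -> 'I_r}) (c : 'I_r) (x : T) :
  #|[set y | connect (shadow (color_class H chi c)) x y]| <= maxn 1 (mc H chi).
Proof.
have [xH|xH] := boolP (x \in vertices (color_class H chi c)).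
  have [C CH <-] := connect_class_component xH.
  by rewrite leq_max (component_le_mc CH) orbT.
rewrite leq_max -(cards1 x) (subset_leq_card _)//.
apply/fintype.subsetP => y; rewrite !inE (sym_connect_sym (@shadow_sym _ _)).
have [//|yx] := eqVneq y x.
move=> /connectP[q]; elim/last_ind: q => [_ xy|q v _].
  by rewrite xy eqxx in yx.
rewrite rcons_path last_rcons => /andP[_ /andP[_ /existsP[e /andP[eH sub]]]] xv.
move/negP: xH => []; apply: (fintype.subsetP (edge_sub_vertices eH)).
by apply: (fintype.subsetP sub); rewrite xv !inE eqxx orbT.
Qed.

Lemma mc_min_le (T : finType) (r : nat) (H : hypergraph T)
    (chi : {ffun {set T} -> 'I_r}) : mc_min r H <= mc H chi.
Proof.
rewrite /mc_min; elim: (index_enum _) (mem_index_enum chi) => //= psi s IH.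
rewrite big_cons inE geq_min => /predU1P[<-|/IH ->]; last exact: orbT.
by rewrite leqnn.
Qed.

Lemma mc_le_vertices (T : finType) (r : nat) (H : hypergraph T)
    (chi : {ffun {set T} -> 'I_r}) : mc H chi <= #|vertices H|.
Proof.
apply/bigmax_leqP => c _; apply/bigmax_leqP => C /and3P[/andP[CH _] _ _].
apply/subset_leq_card/(fintype.subset_trans CH)/bigcupsP => e.
by rewrite inE => /andP[/edge_sub_vertices].
Qed.

(** By [mc_le_vertices], any colouring does at least as well as the default value of the minimum. *)
Lemma mc_min_attained (T : finType) (r : nat) (H : hypergraph T) : 0 < r ->
  exists chi : {ffun {set T} -> 'I_r}, mc H chi <= mc_min r H.
Proof.
move=> r0; rewrite /mc_min.
elim/big_ind: _ => [|m n [chi chim] [psi psin]|chi _]; last by exists chi.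
- by exists [ffun=> Ordinal r0]; exact: mc_le_vertices.
- by rewrite /minn; case: ifP => _; [exists chi|exists psi].
Qed.

(** * Colourings and families of partitions *)

(** An edge of colour c lies in one connectivity class of colour c, hence in one part after merging.
    The classes are the fibres of [fingraph.root]; [0 < B] covers singleton classes. *)
Lemma edges_sub_coarsened (T : finType) (r M k d B : nat) (H : hypergraph T)
    (chi : {ffun {set T} -> 'I_r}) :
  0 < M -> #|T| < M * d.+1 -> d.*2 <= B -> 0 < B ->
  uniform k H -> mc H chi <= B ->
  exists2 f : {ffun 'I_r -> {ffun T -> 'I_M}},
    [forall c, forall i, #|[set x | f c x == i]| <= B] &
    edges H \subset coarsened_edges k f.
Proof.
move=> M0 TM dB B0 kH mcB.
have /fin_all_exists[f fP] : forall c : 'I_r, exists f : {ffun T -> 'I_M},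
    (forall x y, connect (shadow (color_class H chi c)) x y -> f x = f y) /\
    (forall i, #|[set x | f x == i]| <= B).
  move=> c; set S := shadow _.
  have Ssym : connect_sym S by apply: sym_connect_sym; exact: shadow_sym.
  have [|f [f1 f2]] := @merge_fibres_into T M d B (fingraph.root S) M0 TM dB.
    move=> z; have [/existsP[x /eqP <-]|no] :=
        boolP [exists x, fingraph.root S x == z].
      under eq_finset do rewrite eq_sym root_connect//.
      apply: leq_trans (connect_class_le_mc H chi c x) _.
      by rewrite geq_max B0 mcB.
    rewrite (_ : [set x | _] = finset.set0) ?cards0//.
    apply/setP => x; rewrite !inE; apply/negbTE/negP => xz.
    by move/negP: no; apply; apply/existsP; exists x.
  by exists f; split=> // x y; rewrite -root_connect// => /eqP /f1.
exists (finfun f).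
  by apply/forallP => c; apply/forallP => i; rewrite ffunE; have [_] := fP c.
apply/fintype.subsetP => e eH; rewrite inE (forall_inP kH)//=.
apply/existsP; exists (chi e); apply/forall_inP => x xe; apply/forall_inP => y ye.
rewrite ffunE; apply/eqP; have [+ _] := fP (chi e); apply.
by apply: connect_edge xe ye; rewrite inE eH eqxx.
Qed.

Lemma sub_powersetT (T : finType) (E : {set {set T}}) :
  E \subset powerset [set: T].
Proof. by apply/fintype.subsetP => e _; rewrite powersetE finset.subsetT. Qed.

Definition spanning (T : finType) (E : {set {set T}}) : hypergraph T :=
  @Hypergraph T ([set: T], E) (sub_powersetT E).

(** Colour each edge by some [c] for which [f c] is constant on it. Then [f c] is constant on every
    component of colour [c], which thus lies in one fibre. *)
Lemma mc_min_coarsened (T : finType) (r M k B : nat)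
    (f : {ffun 'I_r -> {ffun T -> 'I_M}}) : 0 < r ->
  [forall c, forall i, #|[set x | f c x == i]| <= B] ->
  mc_min r (spanning (coarsened_edges k f)) <= B.
Proof.
move=> r0 fB.
pose chi : {ffun {set T} -> 'I_r} := [ffun e : {set T} =>
  odflt (Ordinal r0) [pick c | [forall x in e, forall y in e, f c x == f c y]]].
apply: leq_trans (mc_min_le _ chi) _.
apply/bigmax_leqP => c _; apply/bigmax_leqP => C /and3P[/andP[_ EC] cC _].
have shf x y : shadow C x y -> f c x = f c y.
  move=> /andP[_ /existsP[e /andP[/(fintype.subsetP EC)]]].
  rewrite inE inE => /andP[/andP[_ ef] /eqP].
  rewrite ffunE; case: pickP => [c' fe|no]; last first.
    by have [c'] := existsP ef; rewrite no.
  move=> /= <-; rewrite finset.subUset !finset.sub1set => /andP[xe ye].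
  by apply/eqP; move/forall_inP: fe => /(_ _ xe)/forall_inP/(_ _ ye).
have [->|[x xC]] := finset.set_0Vmem (vertices C); first by rewrite cards0.
apply: leq_trans (forallP (forallP fB c) (f c x)).
apply/subset_leq_card/fintype.subsetP => y yC; rewrite inE.
move/forall_inP: cC => /(_ _ xC)/forall_inP/(_ _ yC) xy.
have := @closed_connect _ (shadow C) [pred z | f c z == f c x] _ x y xy.
by rewrite !inE eqxx => <- // u v /shf; rewrite !inE => ->.
Qed.

(** * Probability bounds *)

Local Open Scope ring_scope.

Lemma spanningK (T : finType) (H : hypergraph T) :
  vertices H = [set: T]%SET -> spanning (edges H) = H.
Proof.
by move=> VH; apply/val_inj => /=; rewrite -VH /vertices /edges -surjective_pairing.
Qed.

(** The k-sets outside [E] must be absent; these are independent events of probability [1 - p]. *)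
Lemma prob_sub_edges (R : realType) (k n : nat) (p : R) (E : {set {set 'I_n}}) :
  random_hypergraph_prob k p [pred H | edges H \subset E] =
  (1 - p) ^+ #|[set e : {set 'I_n} | (#|e| == k) && (e \notin E)]|.
Proof.
(* Distributing the product of the factors [F e + G e] over all sets [e] sums  *)
(* the weights of all hypergraphs contained in [E], the other terms being 0.   *)
pose F (e : {set 'I_n}) := if (#|e| == k) && (e \in E) then p else 0.
pose G (e : {set 'I_n}) := if #|e| == k then 1 - p else 1.
have -> : (1 - p) ^+ #|[set e : {set 'I_n} | (#|e| == k) && (e \notin E)]| =
    \prod_e (F e + G e).
  rewrite -prodr_const [RHS](bigID (mem [set e : {set 'I_n} | (#|e| == k) && (e \notin E)]))/=.
  rewrite [X in _ = _ * X]big1 ?mulr1.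
    apply: eq_bigr => e; rewrite inE /F /G => /andP[-> /negbTE ->] /=.
    by rewrite add0r.
  move=> e; rewrite inE /F /G; case: (#|e| == k) => /=; last by rewrite add0r.
  by rewrite negbK => ->; rewrite addrC subrK.
rewrite bigA_distr.
pose Q (J : {set {set 'I_n}}) := [forall e in J, #|e| == k] && (J \subset E).
rewrite [RHS](bigID Q)/= [X in _ = _ + X]big1 ?addr0; last first.
  move=> J nQ; have [e eJ Fe] : exists2 e, e \in J & F e = 0.
    move: nQ; rewrite negb_and => /orP[/forall_inPn[e eJ ek]|/subsetPn[e eJ eE]].
      by exists e => //; rewrite /F (negbTE ek).
    by exists e => //; rewrite /F (negbTE eE) andbF.
  by rewrite (bigD1 e)//= eJ Fe mul0r.
rewrite /random_hypergraph_prob.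
rewrite (reindex_onto (@spanning 'I_n) (@edges 'I_n)) /=; last first.
  by move=> H /and3P[/eqP VH _ _]; exact: spanningK.
apply: eq_big => [J|J]; first by rewrite !eqxx /= andbT.
rewrite !eqxx /= andbT => /andP[/forall_inP Jk JE].
rewrite [RHS](bigID (fun e : {set 'I_n} => #|e| == k))/= [X in _ = _ * X]big1 ?mulr1.
  apply: eq_bigr => e ek; rewrite /F /G ek /=; case: ifPn => // eJ.
  by rewrite (fintype.subsetP JE).
move=> e ek; rewrite /F /G (negbTE ek) /=; case: ifPn => // eJ.
by rewrite (Jk e eJ) in ek.
Qed.

Section Probability.
Variables (R : realType) (k n : nat) (p : R).
Hypothesis p01 : 0 <= p <= 1.

Lemma edge_weight_ge0 (H : hypergraph 'I_n) :
  0 <= \prod_(e : {set 'I_n} | #|e| == k) (if e \in edges H then p else 1 - p).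
Proof.
have /andP[p0 p1] := p01.
by apply: prodr_ge0 => e _; case: ifP => _ //; rewrite subr_ge0.
Qed.

Lemma prob_total : random_hypergraph_prob k p (@predT (hypergraph 'I_n)) = 1.
Proof.
transitivity (random_hypergraph_prob k p [pred H : hypergraph 'I_n | edges H \subset [set: {set 'I_n}]%SET]).
  by apply: eq_bigl => H; rewrite /= finset.subsetT.
rewrite prob_sub_edges (_ : [set e | _]%SET = finset.set0) ?cards0 ?expr0//.
by apply/setP => e; rewrite !inE andbF.
Qed.

Lemma prob_compl (A : pred (hypergraph 'I_n)) :
  random_hypergraph_prob k p A + random_hypergraph_prob k p (predC A) = 1.
Proof.
rewrite -prob_total /random_hypergraph_prob [RHS](bigID A)/=.
by congr (_ + _); apply: eq_bigl => H; rewrite /= andbT andbA.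
Qed.

Lemma prob_ge0 (A : pred (hypergraph 'I_n)) : 0 <= random_hypergraph_prob k p A.
Proof. by apply: sumr_ge0 => H _; exact: edge_weight_ge0. Qed.

Lemma prob_union_bound (I : finType) (P : pred I) (A : pred (hypergraph 'I_n))
    (E : I -> {set {set 'I_n}}) :
  (forall H, uniform k H -> A H -> exists2 i, P i & edges H \subset E i) ->
  random_hypergraph_prob k p A <=
    \sum_(i | P i) random_hypergraph_prob k p [pred H | edges H \subset E i].
Proof.
move=> AE; rewrite /random_hypergraph_prob.
under [leRHS]eq_bigr do rewrite big_mkcond.
rewrite exchange_big /= big_mkcond; apply: ler_sum => H _.
have W := edge_weight_ge0 H.
case: ifP => [/and3P[VH kH AH]|_]; last first.
  by apply: sumr_ge0 => i _; case: ifP.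
have [i Pi HE] := AE H kH AH.
rewrite (bigD1 i)//= VH kH HE /= lerDl.
by apply: sumr_ge0 => j _; case: ifP.
Qed.

End Probability.

(** Each factor n - i, i < k, of the falling factorial is at least n / 2. *)
Lemma bin_lower_bound (k n : nat) : (k.*2 <= n)%N ->
  (n ^ k <= 2 ^ k * k`! * 'C(n, k))%N.
Proof.
move=> kn; rewrite -mulnA (mulnC k`!) bin_ffact ffact_prod -{1 2}(card_ord k).
rewrite -!prod_nat_const -big_split /=; apply: leq_prod => i _.
by have := ltn_ord i; lia.
Qed.

Lemma onem_expn_le_expR (R : realType) (p x : R) (m : nat) :
  0 <= p <= 1 -> x <= m%:R -> (1 - p) ^+ m <= expR (- (p * x)).
Proof.
move=> /andP[p0 p1] xm; apply: (@le_trans _ _ (expR (- p) ^+ m)).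
  by apply: lerXn2r; rewrite ?nnegrE ?expR_ge0 ?subr_ge0//; exact: expR_ge1Dx.
by rewrite -expRM_natr ler_expR mulNr lerN2 ler_wpM2l.
Qed.

(** A coarsened k-graph has [mc_min] at most [B], so by the density hypothesis it misses at least
    [eps * 'C(n, k)] k-sets, all of which the random hypergraph must avoid. *)
Lemma prob_mc_min_le (R : realType) (k n r M d B : nat) (p eps : R)
    (A : pred (hypergraph 'I_n)) : 0 <= p <= 1 ->
  (0 < r)%N -> (0 < M)%N -> (n < M * d.+1)%N -> (d.*2 <= B)%N -> (0 < B)%N ->
  (forall G : hypergraph 'I_n, vertices G = [set: 'I_n]%SET -> uniform k G ->
    (1 - eps) * 'C(n, k)%:R <= #|edges G|%:R -> (B < mc_min r G)%N) ->
  (forall H, A H -> (mc_min r H <= B)%N) ->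
  random_hypergraph_prob k p A <=
    ((M ^ n) ^ r)%:R * expR (- (p * (eps * 'C(n, k)%:R))).
Proof.
move=> p01 r0 M0 nM dB B0 HG HA.
pose I := {ffun 'I_r -> {ffun 'I_n -> 'I_M}}.
pose P (f : I) := [forall c, forall i, #|[set x | f c x == i]%SET| <= B]%N.
apply: le_trans (prob_union_bound (P := P) (E := @coarsened_edges _ _ _ k) p01 _) _.
  move=> H kH /HA HB; have [chi chiH] := mc_min_attained H r0.
  apply: (edges_sub_coarsened (d := d) (chi := chi)) => //; first by rewrite card_ord.
  exact: leq_trans HB.
have -> : ((M ^ n) ^ r)%N = #|I| by rewrite !card_ffun !card_ord.
rewrite mulr_natl -sumr_const [leRHS](bigID P)/=.
apply: ler_wpDr; first by apply: sumr_ge0 => f _; exact: expR_ge0.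
apply: ler_sum => f Pf; rewrite prob_sub_edges; apply: onem_expn_le_expR => //.
set E := coarsened_edges k f.
have kE : [set e : {set 'I_n} | (#|e| == k) && (e \notin E)]%SET =
    ([set e : {set 'I_n} | #|e| == k] :\: E)%SET.
  by apply/setP => e; rewrite !inE andbC.
have EK : E \subset [set e : {set 'I_n} | #|e| == k]%SET.
  by apply/fintype.subsetP => e; rewrite !inE => /andP[].
have KC : #|[set e : {set 'I_n} | #|e| == k]%SET| = 'C(n, k).
  by rewrite card_draws card_ord.
rewrite kE cardsDS// KC natrB; last by rewrite -KC subset_leq_card.
rewrite leNgt; apply/negP => HE.
have : (B < mc_min r (spanning E))%N.
  apply: HG; rewrite ?mulrBl ?mul1r //; last by rewrite /edges /=; lra.
  by apply/forall_inP => e; rewrite inE => /andP[].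
by rewrite ltnNge mc_min_coarsened.
Qed.

(** * Choice of constants and the limit *)

Local Open Scope classical_set_scope.

Theorem theorem1p2 (R : realType) (phi : nat -> nat -> R)
  (hphi : forall k r : nat, (2 <= k)%N -> (1 <= r)%N ->
    forall alpha' : R, 0 < alpha' ->
    exists2 eps : R, 0 < eps &
    exists2 t0 : nat, (0 < t0)%N &
    forall (T : finType) (G : hypergraph T) (t : nat),
      (t0 <= t)%N -> #|vertices G| = t -> uniform k G ->
      (1 - eps) * 'C(t, k)%:R <= #|edges G|%:R ->
      (phi r k - alpha') * t%:R <= (mc_min r G)%:R)
  (k r : nat) (hk : (2 <= k)%N) (hr : (1 <= r)%N)
  (alpha : R) (halpha : 0 < alpha)
  (p : nat -> R) (hp : forall n : nat, 0 < p n <= 1)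
  (hpn : (fun n : nat => p n * n%:R ^+ (k - 1)) @ \oo --> +oo) :
  (fun n : nat => random_hypergraph_prob k (p n)
     [pred H : hypergraph 'I_n | (phi r k - alpha) * n%:R <= (mc_min r H)%:R])
    @ \oo --> (1 : R).
Proof.
have hp01 n : 0 <= p n <= 1 by have /andP[/ltW -> ->] := hp n.
set a := phi r k - alpha.
(* For a <= 0 the event is certain. *)
have [a0|a0] := leP a 0.
  rewrite [X in X @ _ --> _](_ : _ = cst 1); first exact: cvg_cst.
  apply/funext => n; rewrite -[RHS](prob_total k n (p n)).
  apply: eq_bigl => H /=; rewrite (le_trans _ (ler0n _ _))//.
  by rewrite mulr_le0_ge0.
(* Spending only half of [alpha] leaves the strict gap [B < mc_min r G]. *)
have a2 : 0 < alpha / 2 by rewrite divr_gt0.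
have [eps eps0 [t0 t00 hG]] := hphi k r hk hr _ a2.
(* Chosen so that [M] parts of more than a n / 2 vertices would exceed n. *)
pose M := (Num.truncn (2 / a)).+1.
have aM : 2 < a * M%:R.
  rewrite mulrC -ltr_pdivrMr// -truncn_lt_nat//.
  by rewrite divr_ge0// ltW.
pose K : R := (2 ^ k * k`!)%:R.
have K0 : 0 < K by rewrite ltr0n muln_gt0 expn_gt0 fact_gt0.
pose c : R := eps / K.
have c0 : 0 < c by rewrite divr_gt0.
apply/cvgrPdist_le => e e0.
near=> n.
have n0 : (0 < n)%N by near: n; exact: nbhs_infty_gt.
have t0n : (t0 <= n)%N by near: n; exact: nbhs_infty_ge.
have kn : (k.*2 <= n)%N by near: n; exact: nbhs_infty_ge.
have an1 : 1 <= a * n%:R.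
  rewrite mulrC -ler_pdivrMr//; near: n; exact: nbhs_infty_ger.
have en1 : 1 <= e * n%:R.
  rewrite mulrC -ler_pdivrMr//; near: n; exact: nbhs_infty_ger.
(* The term [M * r] absorbs the number of families, at most exp(n M r); the extra 1 leaves the
   factor exp(- n). *)
have pn : (M * r + 1)%:R / c <= p n * n%:R ^+ (k - 1).
  by near: n; move/cvgryPge: hpn; apply.
have n0R : 0 < n%:R :> R by rewrite ltr0n.
rewrite -[X in `|X - _|](prob_compl k (p n) [pred H : hypergraph 'I_n | a * n%:R <= (mc_min r H)%:R]).
rewrite addrAC subrr add0r ger0_norm ?prob_ge0//.
have an0 : 0 <= a * n%:R / 2 by rewrite divr_ge0// mulr_ge0// ltW.
apply: le_trans (prob_mc_min_le (M := M) (d := Num.truncn (a * n%:R / 2))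
  (B := Num.truncn (a * n%:R)) (eps := eps) (hp01 n) hr _ _ _ _ _ _) _ => //.
- rewrite -(ltr_nat R) natrM.
  have /andP[_ dn] := truncn_itv an0.
  have : a * n%:R / 2 * M%:R < M%:R * (Num.truncn (a * n%:R / 2)).+1%:R.
    by rewrite mulrC ltr_pM2l// ltr0n.
  apply: le_lt_trans.
  by nra.
- rewrite truncn_ge_nat; last lra.
  rewrite -muln2 natrM; have := truncn_le (a * n%:R / 2); rewrite an0; lra.
- by rewrite truncn_gt0.
- move=> G VG kG hE; rewrite -(ltr_nat R).
  apply: lt_le_trans (hG _ G n t0n _ kG hE); last by rewrite VG cardsT card_ord.
  have := truncn_le (a * n%:R).
  have -> : 0 <= a * n%:R by lra.
  by rewrite /a; nra.
- move=> H; rewrite /= -ltNge => /ltW; rewrite -truncn_ge_nat//; lra.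
have bin_ge : c * n%:R ^+ k <= eps * 'C(n, k)%:R.
  rewrite /c -mulrA ler_pM2l// mulrC ler_pdivrMr// mulrC.
  by rewrite -natrX -natrM ler_nat bin_lower_bound.
(* The crude bound M <= exp(M) suffices. *)
have Mle : ((M ^ n) ^ r)%:R <= expR (n%:R * (M * r)%:R) :> R.
  rewrite -expnM natrX.
  rewrite (_ : n%:R * _ = (n * r)%:R * M%:R); last by rewrite !natrM; ring.
  rewrite expRM_natl; apply: lerXn2r; rewrite ?nnegrE ?expR_ge0//.
  by apply: le_trans (expR_ge1Dx _); rewrite lerDr.
have exp_n : expR (- n%:R) <= e.
  rewrite expRN -[e]invrK lef_pV2 ?posrE ?invr_gt0 ?expR_gt0//.
  apply: le_trans (expR_ge1Dx _).
  rewrite -[e^-1]mul1r ler_pdivrMr//; nra.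
apply: le_trans exp_n.
apply: (@le_trans _ _ (expR (n%:R * (M * r)%:R) * expR (- (p n * (eps * 'C(n, k)%:R))))).
  by rewrite ler_wpM2r ?expR_ge0.
rewrite -expRD ler_expR.
have pc : (M * r + 1)%:R <= c * (p n * n%:R ^+ (k - 1)).
  by rewrite mulrC -ler_pdivrMr.
have nk : n%:R ^+ k = n%:R * n%:R ^+ (k - 1) :> R.
  by rewrite -exprS subn1 prednK// ltnW.
have : n%:R * (M * r + 1)%:R <= p n * (c * n%:R ^+ k).
  rewrite nk (_ : p n * _ = n%:R * (c * (p n * n%:R ^+ (k - 1)))); last ring.
  by rewrite ler_pM2l.
have : p n * (c * n%:R ^+ k) <= p n * (eps * 'C(n, k)%:R).
  by rewrite ler_wpM2l//; have /andP[] := hp01 n.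
rewrite natrD mulrDr mulr1; lra.
Unshelve. all: by end_near.
Qed.
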